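(* Let $R$ be a commutative noetherian local ring with residue field $k$, $M$ a finitely generated $R$-module and $n\ge 0$ an integer. (1) Let $a$ and $b$ be integers with $0<a\le b$. If $\operatorname{Ext}^i_R(M,R)=0$ for all $a\le i\le b$, then the equalities $\xi_R(a-1,M)=\xi_R(a,M)=\cdots=\xi_R(b-1,M)=\xi_R(b,M)$ hold. (2) Suppose $\operatorname{Ext}^i_R(M,R)=0$ for all $1\le i\le n$. Then $\xi_R(j,M)$ is the rank of the largest free summand of $M$ for any $0\le j\le n$.
   Context: $\underline{\operatorname{Hom}}_R(X,Y)$ is the quotient of $\operatorname{Hom}_R(X,Y)$ by the submodule of homomorphisms factoring through a projective module. The syzygy $\Omega M$ of a finitely generated $R$-module is the kernel of a surjection from a finitely generated projective module onto $M$; it is unique up to projective summands and defines a functor $\Omega$ on the stable category $\underline{\operatorname{mod}}R$ (finitely generated $R$-modules with morphisms $\underline{\operatorname{Hom}}_R$); $\Omega^n$ is its $n$-fold iterate. The $n$-th approximated $\xi$-invariant $\xi_R(n,M)$ is the $k$-dimension of the kernel of the composite $\operatorname{Hom}_R(M,k)\to\underline{\operatorname{Hom}}_R(M,k)\xrightarrow{\Omega^n}\underline{\operatorname{Hom}}_R(\Omega^nM,\Omega^nk)$, where the first map is the canonical surjection. *)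

(* Defs.v *)
From HB Require Import structures.
From mathcomp Require Import all_boot all_order all_algebra.
From mathcomp Require Import all_classical.

Set Implicit Arguments.
Unset Strict Implicit.
Unset Printing Implicit Defensive.

Import GRing.Theory.
Local Open Scope ring_scope.
Local Open Scope quotient_scope.

Section Rings.
Variable R : comNzRingType.

Definition is_ideal (I : set R) : Prop :=
  [/\ I 0, forall x y, I x -> I y -> I (x + y) & forall a x, I x -> I (a * x)].

Definition maximal_ideal (m : set R) : Prop :=
  [/\ is_ideal m, ~ m 1 &
      forall I : set R, is_ideal I -> (m `<=` I)%classic -> ~ I 1 -> I = m].

Definition local_ring : Prop := exists! m : set R, maximal_ideal m.

Definition noetherian_ring : Prop :=
  forall I : set R, is_ideal I ->
    exists n (g : 'I_n -> R),
      forall x, I x <-> exists c : 'I_n -> R, x = \sum_i c i * g i.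

(* [R/m], given up to isomorphism as a field onto which R maps with kernel m. *)
Record residueField := ResidueField {
  res_field :> fieldType;
  res_map : {rmorphism R -> res_field};
  res_map_surj : forall y, exists x, res_map x = y;
  res_map_ker : maximal_ideal [set x | res_map x = 0]%classic }.

End Rings.

Definition mk_linear (R : comNzRingType) (A B : lmodType R) (f : A -> B)
    (f_lin : linear f) : {linear A -> B} :=
  HB.pack_for {linear A -> B} f (GRing.isLinear.Build R A B *:%R f f_lin).

Section Modules.
Variable R : comNzRingType.

Definition fin_gen (M : lmodType R) : Prop :=
  exists n (g : 'I_n -> M), forall x, exists c : 'I_n -> R, x = \sum_i c i *: g i.

Record fgMod := FgMod { fg_mod :> lmodType R; fg_modP : fin_gen fg_mod }.

Definition projective (P : lmodType R) : Prop :=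
  forall (A B : lmodType R) (g : {linear A -> B}) (f : {linear P -> B}),
    (forall b, exists a, g a = b) ->
    exists h : {linear P -> A}, forall x, g (h x) = f x.

Definition free_summand (M : lmodType R) (r : nat) : Prop :=
  exists (N : lmodType R) (f : {linear M -> ('rV[R]_r * N)%type}), bijective f.

Definition largest_free_summand_rank (M : lmodType R) (r : nat) : Prop :=
  free_summand M r /\ forall s, free_summand M s -> (s <= r)%N.

Lemma projective_rV n : projective 'rV[R]_n.
Proof.
move=> A B g f gsurj.
have [a aP] := choice (fun i => gsurj (f (delta_mx 0 i))).
pose h (x : 'rV[R]_n) : A := \sum_i x 0 i *: a i.
have hl : linear h.
  move=> c x y; rewrite /h scaler_sumr -big_split /=; apply: eq_bigr => i _.
  by rewrite !mxE scalerDl scalerA.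
exists (mk_linear hl).
move=> x /=; rewrite /h linear_sum [in RHS](row_sum_delta x) linear_sum.
by apply: eq_bigr => i _; rewrite !linearZ /= aP.
Qed.

Lemma projective_prod (P Q : lmodType R) :
  projective P -> projective Q -> projective (P * Q)%type.
Proof.
move=> hP hQ A B g f gsurj.
have l1 : linear (fun x : P => f (x, 0)).
  move=> c x y; rewrite -linearP; congr (f _).
  by apply: injective_projections; rewrite /= ?scaler0 ?addr0.
have l2 : linear (fun x : Q => f (0, x)).
  move=> c x y; rewrite -linearP; congr (f _).
  by apply: injective_projections; rewrite /= ?scaler0 ?addr0.
pose f1 := mk_linear l1.
pose f2 := mk_linear l2.
have [h1 h1P] := hP _ _ g f1 gsurj.
have [h2 h2P] := hQ _ _ g f2 gsurj.
pose h (x : P * Q) := h1 x.1 + h2 x.2.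
have hl : linear h.
  by move=> c x y; rewrite /h /= !linearP scalerDr addrACA.
exists (mk_linear hl).
move=> [x y] /=; rewrite /h /= linearD h1P h2P /= -linearD; congr (f _).
by apply: injective_projections; rewrite /= ?addr0 ?add0r.
Qed.

End Modules.

Section Hom.
Variables (R : comNzRingType) (X Y : lmodType R).

HB.instance Definition _ := gen_eqMixin {linear X -> Y}.
HB.instance Definition _ := gen_choiceMixin {linear X -> Y}.

Lemma linear_ext (f g : {linear X -> Y}) : f =1 g -> f = g.
Proof.
case: f g => [f [[fa] [fb]]] [g [[ga] [gb]]] /= /funext fg.
move: fa fb ga gb; rewrite fg => fa fb ga gb.
by rewrite (Prop_irrelevance fa ga) (Prop_irrelevance fb gb).
Qed.

Definition lin_zero : {linear X -> Y} := \0.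
Definition lin_opp (f : {linear X -> Y}) : {linear X -> Y} := \- f.
Definition lin_add (f g : {linear X -> Y}) : {linear X -> Y} := f \+ g.

Lemma lin_addA : associative lin_add.
Proof. by move=> f g h; apply: linear_ext => x /=; rewrite addrA. Qed.
Lemma lin_addC : commutative lin_add.
Proof. by move=> f g; apply: linear_ext => x /=; rewrite addrC. Qed.
Lemma lin_add0 : left_id lin_zero lin_add.
Proof. by move=> f; apply: linear_ext => x /=; rewrite add0r. Qed.
Lemma lin_addN : left_inverse lin_zero lin_opp lin_add.
Proof. by move=> f; apply: linear_ext => x /=; rewrite addNr. Qed.

HB.instance Definition _ :=
  GRing.isZmodule.Build {linear X -> Y} lin_addA lin_addC lin_add0 lin_addN.

End Hom.

Section StableHom.
Variables (R : comNzRingType) (X Y : lmodType R).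

Definition factors_projective (f : {linear X -> Y}) : Prop :=
  exists (P : lmodType R) (g : {linear X -> P}) (h : {linear P -> Y}),
    projective P /\ f =1 h \o g.

Definition pHom : {pred {linear X -> Y}} := fun f => `[< factors_projective f >].

Lemma pHom_zmod_closed : zmod_closed pHom.
Proof.
split=> [|f1 f2 /asboolP[P1 [g1 [h1 [pP1 e1]]]] /asboolP[P2 [g2 [h2 [pP2 e2]]]]].
  apply/asboolP; exists 'rV[R]_0, \0, \0; split; first exact: projective_rV.
  by [].
apply/asboolP; exists (P1 * P2)%type.
have gl : linear (fun x => (g1 x, g2 x)).
  by move=> c x y; apply: injective_projections; rewrite /= linearP.
have hl : linear (fun p : P1 * P2 => h1 p.1 - h2 p.2).
  by move=> c x y; rewrite /= linearP (linearP h2) scalerBr opprD addrACA.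
exists (mk_linear gl).
exists (mk_linear hl).
split; first exact: projective_prod.
by move=> x /=; rewrite [LHS]/= e1 e2.
Qed.

HB.instance Definition _ :=
  GRing.isZmodClosed.Build {linear X -> Y} pHom pHom_zmod_closed.

(* Only the additive structure of the quotient is used; the R-action is left out. *)
Definition stableHom : Type := Quotient.quot pHom.
HB.instance Definition _ := GRing.Zmodule.on stableHom.
HB.instance Definition _ :=
  EqQuotient.copy stableHom (Quotient.quot pHom).

Definition stable_pi (f : {linear X -> Y}) : stableHom := \pi_stableHom f.

Lemma stable_pi_eq (f g : {linear X -> Y}) :
  stable_pi f = stable_pi g <-> factors_projective (f - g).
Proof.
split=> [/eqP|fg].
  by rewrite /stable_pi -Quotient.idealrBE => /asboolP.
by apply/eqP; rewrite /stable_pi -Quotient.idealrBE; apply/asboolP.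
Qed.

End StableHom.

Section Kernel.
Variables (R : comNzRingType) (A B : lmodType R) (p : {linear A -> B}).

Definition lkernel : {pred A} := fun x => p x == 0.

Lemma lkernel_submod_closed : submod_closed lkernel.
Proof.
split=> [|c x y /eqP x0 /eqP y0]; rewrite unfold_in; first by rewrite linear0.
by rewrite linearP x0 y0 scaler0 addr0.
Qed.

HB.instance Definition _ :=
  GRing.isSubmodClosed.Build R A lkernel lkernel_submod_closed.

Record kerMod := KerMod { ker_val : A; ker_valP : ker_val \in lkernel }.
HB.instance Definition _ := [isSub of kerMod for ker_val].
HB.instance Definition _ := [Choice of kerMod by <:].
HB.instance Definition _ := [SubChoice_isSubLmodule of kerMod by <:].

End Kernel.

Lemma noetherian_submod (R : comNzRingType) (nR : noetherian_ring R)
    (A : lmodType R) (N : set A) n (g : 'I_n -> A) :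
    N 0 -> (forall x y, N x -> N y -> N (x + y)) ->
    (forall a x, N x -> N (a *: x)) ->
    (forall x, N x -> exists c : 'I_n -> R, x = \sum_i c i *: g i) ->
  exists m (h : 'I_m -> A), (forall i, N (h i)) /\
    forall x, N x -> exists c : 'I_m -> R, x = \sum_i c i *: h i.
Proof.
elim: n N g => [|n IHn] N g N0 ND NZ Ng.
  exists 0, (fun _ => 0); split=> [[]|] // x /Ng[c ->].
  by exists (fun _ => 0); rewrite !big_ord0.
pose I : set R := [set a | exists c : 'I_n -> R,
  N (a *: g ord0 + \sum_i c i *: g (lift ord0 i))]%classic.
have NB (r : nat) (a : 'I_r -> R) (h : 'I_r -> A) :
    (forall i, N (h i)) -> N (\sum_i a i *: h i).
  by move=> Nh; elim/big_ind: _ => // i _; apply: NZ.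
have idI : is_ideal I.
  split.
  - by exists (fun _ => 0); rewrite scale0r add0r big1 // => i _; rewrite scale0r.
  - move=> a b [c Nc] [d Nd]; exists (fun i => c i + d i).
    have -> : \sum_i (c i + d i) *: g (lift ord0 i) =
        \sum_i c i *: g (lift ord0 i) + \sum_i d i *: g (lift ord0 i).
      by rewrite -big_split; apply: eq_bigr => i _; rewrite scalerDl.
    by rewrite scalerDl addrACA; apply: ND.
  move=> a b [c Nc]; exists (fun i => a * c i).
  have -> : \sum_i (a * c i) *: g (lift ord0 i) = a *: \sum_i c i *: g (lift ord0 i).
    by rewrite scaler_sumr; apply: eq_bigr => i _; rewrite scalerA.
  by rewrite -scalerA -scalerDr; apply: NZ.
have [m [a aP]] := nR I idI.
have Ia i : I (a i).
  apply/aP; exists (fun j => (j == i)%:R); rewrite (bigD1 i) //= eqxx mul1r.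
  by rewrite big1 ?addr0 // => j /negPf ->; rewrite mul0r.
have [c cP] := choice Ia.
pose N' : set A := [set x | N x /\ exists d : 'I_n -> R,
  x = \sum_i d i *: g (lift ord0 i)]%classic.
have [||||p [z [zN zP]]] := IHn N' (fun i => g (lift ord0 i)).
- by split=> //; exists (fun _ => 0); rewrite big1 // => i _; rewrite scale0r.
- move=> x y [Nx [d xd]] [Ny [e ye]]; split; first exact: ND.
  exists (fun i => d i + e i); rewrite xd ye -big_split.
  by apply: eq_bigr => i _; rewrite scalerDl.
- move=> b x [Nx [d xd]]; split; first exact: NZ.
  exists (fun i => b * d i); rewrite xd scaler_sumr.
  by apply: eq_bigr => i _; rewrite scalerA.
- by move=> x [].
pose y i := a i *: g ord0 + \sum_j c i j *: g (lift ord0 j).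
exists (m + p)%N, (fun i : 'I_(m + p) => match fintype.split i with inl i => y i | inr j => z j end).
split=> [i|x Nx]; first by case: (fintype.split i) => j; [apply: cP | case: (zN j)].
have [e xe] := Ng x Nx.
have /aP[r er] : I (e ord0) by exists (fun i => e (lift ord0 i)); rewrite -(big_ord_recl n (fun i => e i *: g i)) -xe.
have [|d xd] := zP (x - \sum_i r i *: y i).
  split; first by rewrite -scaleN1r; apply: ND => //; apply/NZ/NB => i; apply: cP.
  exists (fun j => e (lift ord0 j) - \sum_i r i * c i j).
  have -> : \sum_i r i *: y i = e ord0 *: g ord0 +
      \sum_j (\sum_i r i * c i j) *: g (lift ord0 j).
    rewrite er scaler_suml; under [X in _ = _ + X]eq_bigr do rewrite scaler_suml.
    rewrite exchange_big -big_split; apply: eq_bigr => i _.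
    rewrite /y scalerDr scalerA scaler_sumr; congr (_ + _).
    by apply: eq_bigr => j _; rewrite scalerA.
  rewrite {1}xe big_ord_recl opprD addrACA subrr add0r -sumrB.
  by apply: eq_bigr => j _; rewrite scalerBl.
exists (fun i : 'I_(m + p) => match fintype.split i with inl i => r i | inr j => d j end).
rewrite big_split_ord /=.
under eq_bigr => i _ do rewrite (unsplitK (inl i)).
under [X in _ + X]eq_bigr => i _ do rewrite (unsplitK (inr i)).
by rewrite -xd addrC subrK.
Qed.

Lemma fin_gen_ker (R : comNzRingType) (nR : noetherian_ring R)
    (A B : lmodType R) (p : {linear A -> B}) : fin_gen A -> fin_gen (kerMod p).
Proof.
case=> n [g gP].
have [||||m [h [hN hP]]] :=
  @noetherian_submod R nR A [set x | p x = 0]%classic n g.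
- exact: linear0.
- by move=> x y /= x0 y0; rewrite linearD x0 y0 addr0.
- by move=> a x /= x0; rewrite linearZ /= x0 scaler0.
- by move=> x _; apply: gP.
have hK i : h i \in lkernel p by apply/eqP; apply: hN.
exists m, (fun i => KerMod (hK i)) => x.
have [|c xc] := hP (val x); first by apply/eqP; apply: (valP x).
exists c; apply: val_inj; rewrite xc [RHS]linear_sum /=.
by apply: eq_bigr => i _.
Qed.

Section Syzygy.
Variable R : comNzRingType.

Record projOnto (M : fgMod R) := ProjOnto {
  po_mod :> lmodType R;
  po_fg : fin_gen po_mod;
  po_proj : projective po_mod;
  po_map : {linear po_mod -> M};
  po_surj : forall y, exists x, po_map x = y }.

Lemma projOnto_exists (M : fgMod R) : inhabited (projOnto M).
Proof.
have [n [g gP]] := fg_modP M.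
pose h (x : 'rV[R]_n) : M := \sum_i x 0 i *: g i.
have hl : linear h.
  move=> c x y; rewrite /h scaler_sumr -big_split /=; apply: eq_bigr => i _.
  by rewrite !mxE scalerDl scalerA.
constructor; apply: (@ProjOnto M 'rV[R]_n _ _ (mk_linear hl)).
- exists n, (fun i => delta_mx 0 i) => x; exists (fun i => x 0 i).
  exact: row_sum_delta.
- exact: projective_rV.
- move=> y; have [c ->] := gP y; exists (\row_i c i).
  by apply: eq_bigr => i _; rewrite mxE.
Qed.

Hypothesis nR : noetherian_ring R.

(* Syzygies are only unique up to projective summands, so Omega is formed with
   respect to an arbitrary choice S of the surjections. *)
Variable S : forall M : fgMod R, projOnto M.

Definition syz (M : fgMod R) : fgMod R :=
  FgMod (fin_gen_ker nR (po_map (S M)) (po_fg (S M))).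

Section SyzMap.
Variables X Y : fgMod R.

Definition is_lift (f : {linear X -> Y}) (F : {linear S X -> S Y}) : Prop :=
  forall x, po_map (S Y) (F x) = f (po_map (S X) x).

Lemma lift_exists f : exists F, is_lift f F.
Proof.
exact: (@po_proj X (S X) (S Y) Y (po_map (S Y)) (f \o po_map (S X)) (@po_surj Y (S Y))).
Qed.

Definition lift_hom f : {linear S X -> S Y} := sval (cid (lift_exists f)).

Lemma lift_homP f : is_lift f (lift_hom f).
Proof. exact: (svalP (cid (lift_exists f))). Qed.

Lemma lift_ker f F (FP : is_lift f F) (x : syz X) :
  F (ker_val x) \in lkernel (po_map (S Y)).
Proof.
by case: x => x /= /eqP x0; rewrite unfold_in FP x0 linear0.
Qed.

Lemma lift_ker_linear f F (FP : is_lift f F) :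
  linear (fun x : syz X => KerMod (lift_ker FP x) : syz Y).
Proof. by move=> c x y; apply: val_inj; rewrite /= linearP. Qed.

Definition syz_lift f F (FP : is_lift f F) : {linear syz X -> syz Y} :=
  mk_linear (lift_ker_linear FP).

Definition Omega (u : stableHom X Y) : stableHom (syz X) (syz Y) :=
  stable_pi (syz_lift (lift_homP (repr u))).

Lemma Omega_pi f F (FP : is_lift f F) :
  Omega (stable_pi f) = stable_pi (syz_lift FP).
Proof.
rewrite /Omega; set r := repr _; set G := lift_hom r.
have [Q [g [h [pQ hg]]]] : factors_projective (r - f).
  by apply/stable_pi_eq; rewrite /stable_pi reprK.
have [h' h'P] := pQ _ _ (po_map (S Y)) h (@po_surj Y (S Y)).
apply/stable_pi_eq.
pose K : {linear S X -> S Y} := (G \- F) \- (h' \o (g \o po_map (S X))).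
have Kker x : K x \in lkernel (po_map (S Y)).
  rewrite unfold_in /K !linearB /= lift_homP FP h'P -[h _]/((h \o g) _) -hg.
  by rewrite subrr.
have Klin : linear (fun x => KerMod (Kker x) : syz Y).
  by move=> c x y; apply: val_inj; rewrite [LHS]linearP.
have vlin : linear (fun x : syz X => ker_val x : S X) by [].
exists (S X), (mk_linear vlin), (mk_linear Klin); split; first exact: po_proj.
move=> x; apply: val_inj; rewrite /= /K.
have -> : po_map (S X) (ker_val x) = 0 by apply/eqP; apply: (valP x).
by rewrite !linear0 addr0.
Qed.

End SyzMap.

Fixpoint syz_iter (n : nat) (M : fgMod R) : fgMod R :=
  if n is m.+1 then syz (syz_iter m M) else M.

Fixpoint Omega_iter (n : nat) (X Y : fgMod R) (u : stableHom X Y) :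
    stableHom (syz_iter n X) (syz_iter n Y) :=
  if n is m.+1 then Omega (Omega_iter m u) else u.

End Syzygy.

Section ResidueModule.
Variables (R : comNzRingType) (k : residueField R).

Definition resMod : Type := res_field k.
HB.instance Definition _ := GRing.Zmodule.on resMod.

Definition res_scale (a : R) (x : resMod) : resMod := res_map k a * (x : k).

Fact res_scaleA a b x : res_scale a (res_scale b x) = res_scale (a * b) x.
Proof. by rewrite /res_scale rmorphM mulrA. Qed.
Fact res_scale1 : left_id 1 res_scale.
Proof. by move=> x; rewrite /res_scale rmorph1 mul1r. Qed.
Fact res_scaleDr : right_distributive res_scale +%R.
Proof. by move=> a x y; rewrite /res_scale mulrDr. Qed.
Fact res_scaleDl x : {morph res_scale^~ x : a b / a + b}.
Proof. by move=> a b; rewrite /res_scale rmorphD mulrDl. Qed.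

HB.instance Definition _ := GRing.Zmodule_isLmodule.Build R resMod
  res_scaleA res_scale1 res_scaleDr res_scaleDl.

Lemma fin_gen_res : fin_gen resMod.
Proof.
exists 1%N, (fun _ => (1 : k)) => x.
have [a ax] := @res_map_surj _ k x.
by exists (fun _ => a); rewrite big_ord1 -ax -[LHS]mulr1.
Qed.

Definition resFg : fgMod R := FgMod fin_gen_res.

Variable M : lmodType R.

Fact res_hom_scale_linear (c : k) (f : {linear M -> resMod}) :
  linear (fun x => c * (f x : k) : resMod).
Proof.
move=> a x y; rewrite linearP [LHS]mulrDr; congr (_ + _).
exact: mulrCA.
Qed.

Definition res_hom_scale (c : k) (f : {linear M -> resMod}) :
  {linear M -> resMod} := mk_linear (res_hom_scale_linear c f).

Fact res_hom_scaleA c d f :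
  res_hom_scale c (res_hom_scale d f) = res_hom_scale (c * d) f.
Proof. by apply: linear_ext => x; apply: mulrA. Qed.
Fact res_hom_scale1 : left_id 1 res_hom_scale.
Proof. by move=> f; apply: linear_ext => x; apply: mul1r. Qed.
Fact res_hom_scaleDr : right_distributive res_hom_scale +%R.
Proof. by move=> c f g; apply: linear_ext => x; apply: mulrDr. Qed.
Fact res_hom_scaleDl f : {morph res_hom_scale^~ f : c d / c + d}.
Proof. by move=> c d; apply: linear_ext => x; apply: mulrDl. Qed.

HB.instance Definition _ := GRing.Zmodule_isLmodule.Build k {linear M -> resMod}
  res_hom_scaleA res_hom_scale1 res_hom_scaleDr res_hom_scaleDl.

End ResidueModule.

Section Dimension.
Variables (K : fieldType) (W : lmodType K) (V : set W).

Definition is_basis (d : nat) (b : 'I_d -> W) : Prop :=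
  [/\ forall i, V (b i),
      forall c : 'I_d -> K, \sum_i c i *: b i = 0 -> forall i, c i = 0 &
      forall v, V v -> exists c : 'I_d -> K, v = \sum_i c i *: b i].

(* For a subspace V; 0 by convention if V has no finite basis. *)
Definition dimension : nat :=
  xget 0%N [set d | exists b : 'I_d -> W, is_basis b]%classic.

Lemma basis_size_le d e (b : 'I_d -> W) (b' : 'I_e -> W) :
  is_basis b -> is_basis b' -> (d <= e)%N.
Proof.
move=> [Vb bfree _] [_ _ b'gen].
have [c cP] := choice (fun i => b'gen _ (Vb i)).
pose A := \matrix_(i < d, j < e) c i j.
suff : row_free A by rewrite /row_free => /eqP <-; apply: rank_leq_col.
apply: inj_row_free => v vA; apply/rowP => i; rewrite mxE.
apply: (bfree (fun i => v 0 i)).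
under eq_bigr => j _ do rewrite cP scaler_sumr.
rewrite exchange_big big1 // => j _.
transitivity ((v *m A) 0 j *: b' j); last by rewrite vA mxE scale0r.
by rewrite mxE scaler_suml; apply: eq_bigr => l _; rewrite mxE scalerA.
Qed.

Lemma dimensionP d (b : 'I_d -> W) : is_basis b -> dimension = d.
Proof.
move=> bB; rewrite /dimension; case: xgetP => [e _ [b' b'B]|/(_ d) []]; last first.
  by exists b.
by apply/eqP; rewrite eqn_leq !(basis_size_le bB b'B, basis_size_le b'B bB).
Qed.

End Dimension.

Definition xi (R : comNzRingType) (nR : noetherian_ring R)
    (S : forall M : fgMod R, projOnto M) (k : residueField R)
    (n : nat) (M : fgMod R) : nat :=
  @dimension k {linear M -> resMod k}
    [set f | Omega_iter nR S n (stable_pi f : stableHom M (resFg k)) = 0]%classic.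

Record projRes (R : comNzRingType) (M : lmodType R) := ProjRes {
  pr_mod :> nat -> lmodType R;
  pr_diff : forall i, {linear pr_mod i.+1 -> pr_mod i};
  pr_aug : {linear pr_mod 0 -> M};
  pr_proj : forall i, projective (pr_mod i);
  pr_aug_surj : forall y, exists x, pr_aug x = y;
  pr_exact0 : forall x, pr_aug x = 0 <-> exists y, pr_diff 0 y = x;
  pr_exact : forall i x, pr_diff i x = 0 <-> exists y, pr_diff i.+1 y = x }.

Section Ext.
Variables (R : comNzRingType) (M : lmodType R) (P : projRes M).
Variables (i : nat) (N : lmodType R).

Definition cocycle : {pred {linear P i -> N}} :=
  fun f => `[< f \o pr_diff P i =1 \0 >].

Lemma cocycle_zmod_closed : zmod_closed cocycle.
Proof.
split=> [|f g /asboolP f0 /asboolP g0]; apply/asboolP => x //=.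
by rewrite -[LHS]/(f _ - g _) [f _]f0 [g _]g0 subrr.
Qed.

HB.instance Definition _ :=
  GRing.isZmodClosed.Build {linear P i -> N} cocycle cocycle_zmod_closed.

Record cocycles := Cocycles { cocycle_val : {linear P i -> N};
                              cocycle_valP : cocycle_val \in cocycle }.
HB.instance Definition _ := [isSub of cocycles for cocycle_val].
HB.instance Definition _ := [Choice of cocycles by <:].
HB.instance Definition _ := [SubChoice_isSubZmodule of cocycles by <:].

Definition is_coboundary : {linear P i -> N} -> Prop :=
  match i with
  | 0 => fun f => f =1 \0
  | j.+1 => fun f => exists g : {linear P j -> N}, f =1 g \o pr_diff P j
  end.

Definition coboundary : {pred cocycles} :=
  fun z => `[< is_coboundary (cocycle_val z) >].

Lemma coboundary_zmod_closed : zmod_closed coboundary.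
Proof.
split=> [|z w /asboolP hz /asboolP hw]; apply/asboolP.
  rewrite -[cocycle_val _]/(val (0 : cocycles)) raddf0 /is_coboundary.
  by case: (i) => [|j] //; exists \0.
rewrite -[cocycle_val _]/(val (z - w)) raddfB /=.
move: (cocycle_val z) (cocycle_val w) hz hw; rewrite /is_coboundary.
case: (i) => [|j] f g.
  by move=> f0 g0 x; rewrite -[LHS]/(f x - g x) f0 g0 subrr.
by move=> [f' ff'] [g' gg']; exists (f' \- g') => x; rewrite -[LHS]/(f x - g x) ff' gg'.
Qed.

HB.instance Definition _ :=
  GRing.isZmodClosed.Build cocycles coboundary coboundary_zmod_closed.

(* H^i(Hom(P, N)) = Ext^i(M, N); again only as an abelian group. *)
Definition Ext : Type := Quotient.quot coboundary.
HB.instance Definition _ := GRing.Zmodule.on Ext.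

Definition Ext_vanishes : Prop := forall x : Ext, x = 0.

End Ext.

Lemma projRes_exists (R : comNzRingType) (nR : noetherian_ring R)
    (S : forall M : fgMod R, projOnto M) (M : fgMod R) : inhabited (projRes M).
Proof.
pose Z i := syz_iter nR S i M.
have vlin i : linear (fun x : syz nR S (Z i) => ker_val x : S (Z i)) by [].
pose d i : {linear S (Z i.+1) -> S (Z i)} :=
  mk_linear (vlin i) \o po_map (S (Z i.+1)).
have im i x : po_map (S (Z i)) x = 0 <-> exists y, d i y = x.
  split=> [x0|[y <-]]; last by apply/eqP; apply: (valP (po_map (S (Z i.+1)) y)).
  have kx : x \in lkernel (po_map (S (Z i))) by apply/eqP.
  have [y yx] := @po_surj R _ (S (Z i.+1)) (KerMod kx).
  by exists y; rewrite /d /= yx.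
constructor; apply: (@ProjRes R M (fun i => S (Z i)) d (po_map (S (Z 0%N)))).
- by move=> i; apply: po_proj.
- exact: po_surj.
- exact: (im 0%N).
- move=> i x; rewrite -(im i.+1); split=> [x0|x0].
    by apply: val_inj.
  by rewrite /d /= x0.
Qed.

(* Main.v *)
Require Import Defs.
From mathcomp Require Import all_boot all_order all_algebra.
From mathcomp Require Import boolp classical_sets.

Set Implicit Arguments.
Unset Strict Implicit.
Unset Printing Implicit Defensive.

Import GRing.Theory.
Local Open Scope ring_scope.

(** The proof rests on two facts.

    If Ext^1(X, R) = 0, then Omega is injective on stable maps X -> Y
    ([Omega_inj]).  Indeed, let f : X -> Y have a lift F : S X -> S Y whose
    restriction to the syzygies factors through a projective module, which may
    be taken finitely generated.  Then Ext^1(X, -) vanishes on that module, so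
    the factorization extends to S X; subtracting it from F gives a lift of f
    that vanishes on syz X, hence f factors through S Y.  Applied to the
    (i-1)-st syzygy of M, this shows that the kernels defining xi(i-1, M) and
    xi(i, M) are the same set when Ext^i(M, R) = 0 ([xi_succ]).  The dimension
    shift Ext^i(M, R) = Ext^1(syz_(i-1) M, R) compares the given resolution
    with the chosen surjections: a stable retraction between two modules
    induces one between their syzygies ([stable_retract_ker]), and vanishing
    of Ext^1 passes to stable retracts ([ker_ext_stable_retract]).

    The number xi(0, M) is the largest rank of a free summand of M
    ([xi0_largest_free_summand]).  A free summand of rank d is the same as a
    dual system phi_i : M -> R, x_j in M with phi_i(x_j) = delta_ij, and d is
    at most the number of generators of M.  A map M -> k factors through a
    projective module exactly when it lifts to a functional psi : M -> R.  For
    a dual system of maximal size, psi - sum_j psi(x_j) phi_j kills every x_j,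
    so it takes no unit value, since otherwise the system could be enlarged
    ([dual_system_extend]); as R is local, it reduces to 0 in k.  Hence the
    reductions of the phi_i form a basis of the space whose dimension is
    xi(0, M). *)

(** * Syzygies and vanishing of Ext^1 *)

Section Comparison.
Variable R : comNzRingType.

Definition surj (A B : lmodType R) (p : {linear A -> B}) : Prop :=
  forall y, exists x, p x = y.

Section Corestriction.
Variables (A B C : lmodType R) (p : {linear A -> B}) (f : {linear C -> A}).
Hypothesis pf0 : forall x, p (f x) = 0.

Fact ker_corestr_subproof x : f x \in lkernel p.
Proof. exact/eqP. Qed.

Fact ker_corestr_linear :
  linear (fun x => KerMod (ker_corestr_subproof x) : kerMod p).
Proof. by move=> c x y; apply: val_inj; rewrite /= linearP. Qed.

(** A linear map into A that p kills, seen as a map into the kernel of p. *)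
Definition ker_corestr : {linear C -> kerMod p} := mk_linear ker_corestr_linear.

End Corestriction.

Fact ker_incl_linear (A B : lmodType R) (p : {linear A -> B}) :
  linear (fun z : kerMod p => ker_val z).
Proof. by []. Qed.

(** The inclusion of the kernel of p, as a linear map. *)
Definition ker_incl (A B : lmodType R) (p : {linear A -> B}) :
  {linear kerMod p -> A} := mk_linear (@ker_incl_linear A B p).

Lemma ker_inclE (A B : lmodType R) (p : {linear A -> B}) (z : kerMod p) :
  p (ker_incl p z) = 0.
Proof. exact/eqP/(valP z). Qed.

(** X is a retract of X' in the stable category: id_X - b a factors through
    the projective module W.  The module W need not be finitely generated, so
    that syzygies taken in arbitrary projective resolutions are covered. *)
Definition stable_retract (X X' : lmodType R) : Prop :=
  exists (a : {linear X -> X'}) (b : {linear X' -> X}) (W : lmodType R)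
         (g : {linear X -> W}) (h : {linear W -> X}),
    projective W /\ forall x, x = b (a x) + h (g x).

Lemma stable_retract_refl X : stable_retract X X.
Proof.
exists idfun, idfun, 'rV[R]_0, \0, \0; split; first exact: projective_rV.
by move=> x /=; rewrite addr0.
Qed.

Section Covers.
Variables (X X' Q Q' : lmodType R).
Variables (p : {linear Q -> X}) (p' : {linear Q' -> X'}).
Hypotheses (pQ : projective Q) (pQ' : projective Q') (sp : surj p) (sp' : surj p').

(** The maps a : X -> X' and b : X' -> X of a stable retraction lift to maps
    A : Q -> Q' and B : Q' -> Q.  These restrict to maps a' and b' between the
    kernels, and id - b' a' extends to a map K from all of Q to the kernel
    of p. *)
Lemma stable_retract_cover : stable_retract X X' ->
  exists (A : {linear Q -> Q'}) (a' : {linear kerMod p -> kerMod p'})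
         (b' : {linear kerMod p' -> kerMod p}) (K : {linear Q -> kerMod p}),
    (forall z, ker_val (a' z) = A (ker_val z)) /\
    forall z, z = b' (a' z) + K (ker_val z).
Proof.
case=> a [b [W [g [h [pW e]]]]].
have [A AP] := pQ (a \o p) sp'.
have [B BP] := pQ' (b \o p') sp.
have [h' h'P] := pW _ _ p h sp.
have A0 z : p' ((A \o ker_incl p) z) = 0.
  by rewrite [A]lock /= -lock AP /= [X in a X]ker_inclE linear0.
have B0 z : p ((B \o ker_incl p') z) = 0.
  by rewrite [B]lock /= -lock BP /= [X in b X]ker_inclE linear0.
(* id - B A agrees with h' g p modulo ker p, because id - b a = h g. *)
pose K : {linear Q -> Q} := (idfun \- (B \o A)) \- (h' \o (g \o p)).
have K0 x : p (K x) = 0.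
  rewrite /K !linearB /= BP h'P /= AP /=.
  by apply/eqP; rewrite subr_eq0 subr_eq addrC -e.
exists A, (ker_corestr A0), (ker_corestr B0), (ker_corestr K0); split=> // z.
apply: val_inj; rewrite raddfD /= /K /=.
have -> : p (ker_val z) = 0 by apply: ker_inclE.
by rewrite !linear0 addr0 addrC subrK.
Qed.

Lemma stable_retract_ker :
  stable_retract X X' -> stable_retract (kerMod p) (kerMod p').
Proof.
case/stable_retract_cover=> _ [a' [b' [K [_ e]]]].
by exists a', b', Q, (ker_incl p), K.
Qed.

(** Every linear map from ker q to N extends to A.  When A is projective and
    q is surjective, this says that Ext^1(B, N) = 0. *)
Definition ker_ext (A B : lmodType R) (q : {linear A -> B}) (N : lmodType R) : Prop :=
  forall g : {linear kerMod q -> N},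
    exists G : {linear A -> N}, forall z, G (ker_val z) = g z.

(** Vanishing of Ext^1 is inherited by stable retracts.  With X' = X, it does
    not depend on the surjection from a projective module used to express it. *)
Lemma ker_ext_stable_retract N :
  stable_retract X X' -> ker_ext p' N -> ker_ext p N.
Proof.
case/stable_retract_cover=> A [a' [b' [K [Aa' e]]]] ext g.
have [G GP] := ext (g \o b').
exists ((G \o A) \+ (g \o K)) => z /=.
by rewrite -Aa' GP /= -linearD -e.
Qed.

End Covers.

Lemma ker_ext_fg_projective (A B Q : lmodType R) (q : {linear A -> B}) :
  fin_gen Q -> projective Q -> ker_ext q R^o -> ker_ext q Q.
Proof.
case=> n [e eP] pQ ext g.
have pl : linear (fun v : 'rV[R]_n => \sum_i v 0 i *: e i).
  move=> c x y; rewrite scaler_sumr -big_split /=; apply: eq_bigr => i _.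
  by rewrite !mxE scalerDl scalerA.
have sp : surj (mk_linear pl).
  move=> y; have [c ->] := eP y; exists (\row_i c i).
  by apply: eq_bigr => i _; rewrite mxE.
(* A section s of R^n -> Q reduces the extension to the n coordinates. *)
have [s sP] := pQ _ _ (mk_linear pl) idfun sp.
have cl i : linear (fun z => s (g z) 0 i : R^o).
  by move=> c x y; rewrite !linearP !mxE.
have [G GP] := choice (fun i => ext (mk_linear (cl i))).
have Hl : linear (fun x => \sum_i (G i x : R) *: e i).
  move=> c x y; rewrite scaler_sumr -big_split /=; apply: eq_bigr => i _.
  by rewrite linearP scalerDl scalerA.
exists (mk_linear Hl) => z /=.
by rewrite -[RHS](sP (g z)) /=; apply: eq_bigr => i _; rewrite GP.
Qed.

End Comparison.

(** * Injectivity of Omega *)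

Section Resolutions.
Variable R : comNzRingType.

Lemma Ext_vanishes_coboundary (M : lmodType R) (P : projRes M) j (N : lmodType R)
    (f : {linear P j.+1 -> N}) :
  Ext_vanishes P j.+1 N -> (forall x, f (pr_diff P j.+1 x) = 0) ->
  exists g : {linear P j -> N}, f =1 g \o pr_diff P j.
Proof.
move=> E0 f0.
have fc : f \in @cocycle R M P j.+1 N by apply/asboolP.
have := E0 (\pi_(Quotient.quot (@coboundary R M P j.+1 N)) (Cocycles fc))%qT.
rewrite -(raddf0 (\pi_(Quotient.quot (@coboundary R M P j.+1 N)))%qT) => /eqP.
by rewrite -Quotient.idealrBE subr0 => /asboolP.
Qed.

Variables (nR : noetherian_ring R) (S : forall X : fgMod R, projOnto X).

(** The j-th syzygy X of M formed in the resolution P comes with the surjection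
    q from P j; the j-th syzygy formed with the surjections S is a stable
    retract of it. *)
Lemma resolution_syzygy (M : fgMod R) (P : projRes M) j :
  exists (X : lmodType R) (q : {linear P j -> X}),
    [/\ surj q, forall x, q x = 0 <-> exists y, pr_diff P j y = x &
        stable_retract (syz_iter nR S j M) X].
Proof.
elim: j => [|j [X [q [sq q0 r]]]].
  exists M, (pr_aug P); split; [exact: pr_aug_surj | exact: pr_exact0 |].
  exact: stable_retract_refl.
have qd x : q (pr_diff P j x) = 0 by apply/q0; exists x.
exists (kerMod q), (ker_corestr qd); split.
- move=> [y y0]; have /q0[x xy] := eqP y0.
  by exists x; apply: val_inj.
- move=> x; rewrite -pr_exact; split=> [/(congr1 val) //|x0].
  by apply: val_inj.
- by apply: stable_retract_ker r; [exact: po_proj|exact: pr_proj|exact: po_surj|].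
Qed.

(** Dimension shifting: Ext^(j+1)(M, N) = 0 gives Ext^1(syz_j M, N) = 0. *)
Lemma Ext_vanishes_ker_ext (M : fgMod R) (P : projRes M) j (N : lmodType R) :
  Ext_vanishes P j.+1 N -> ker_ext (po_map (S (syz_iter nR S j M))) N.
Proof.
move=> E0; have [X [q [sq q0 r]]] := resolution_syzygy P j.
apply: (ker_ext_stable_retract _ _ _ sq r); [exact: po_proj|exact: pr_proj|exact: po_surj|].
move=> g.
have qd x : q (pr_diff P j x) = 0 by apply/q0; exists x.
have [|G GP] := Ext_vanishes_coboundary (f := g \o ker_corestr qd) E0.
  move=> x; rewrite /= -[RHS](linear0 g); congr (g _); apply: val_inj => /=.
  by apply/pr_exact; exists x.
exists G => z; have /q0[x xz] := ker_inclE z.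
by rewrite -[ker_val z]xz -[LHS]GP /=; congr (g _); apply: val_inj.
Qed.

Lemma stable_pi_eq0 (X Y : lmodType R) (f : {linear X -> Y}) :
  stable_pi f = 0 <-> factors_projective f.
Proof.
have <- : stable_pi (0 : {linear X -> Y}) = 0.
  exact: (raddf0 (\pi_(Quotient.quot (@pHom R X Y)))%qT).
by rewrite stable_pi_eq subr0.
Qed.

Lemma Omega0 (X Y : fgMod R) : Omega nR S (0 : stableHom X Y) = 0.
Proof.
have /stable_pi_eq0 <- : factors_projective (0 : {linear X -> Y}).
  by exists 'rV[R]_0, \0, \0; split; first exact: projective_rV.
have L : @is_lift R S X Y (0 : {linear X -> Y}) \0 by move=> x; rewrite /= linear0.
rewrite (Omega_pi nR L); apply/stable_pi_eq0.
exists 'rV[R]_0, \0, \0; split; first exact: projective_rV.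
by move=> x; apply: val_inj.
Qed.

(** Omega is injective on stable maps out of X when Ext^1(X, R) = 0. *)
Lemma Omega_inj (X Y : fgMod R) (u : stableHom X Y) :
  ker_ext (po_map (S X)) R^o -> Omega nR S u = 0 -> u = 0.
Proof.
rewrite -[u]reprK -/(stable_pi _); move: (repr u) => {u} f ext.
have FP := @lift_homP R S X Y f; set F := lift_hom S f in FP.
rewrite (Omega_pi nR FP) stable_pi_eq0 => -[W [g [h [pW e]]]].
(* The projective module W may be replaced by the finitely generated T, and
   then the map from syz X to T extends to S X. *)
pose T := S (syz nR S Y).
have [h' h'P] := pW _ _ (po_map T) h (@po_surj _ _ T).
have [G GP] := ker_ext_fg_projective (po_fg T) (@po_proj _ _ T) ext (h' \o g).
(* D is another lift of f, and it vanishes on syz X: it induces a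
   factorization of f through S Y. *)
pose D : {linear S X -> S Y} := F \- (ker_incl (po_map (S Y)) \o (po_map T \o G)).
have DE x : po_map (S Y) (D x) = f (po_map (S X) x).
  rewrite /D linearB /= FP.
  have -> : po_map (S Y) (ker_val (po_map T (G x))) = 0 by apply: ker_inclE.
  by rewrite subr0.
have D0 x : po_map (S X) x = 0 -> D x = 0.
  move=> x0; have kx : x \in lkernel (po_map (S X)) by apply/eqP.
  rewrite /D /= -[x in G x]/(ker_val (KerMod kx)) GP /= h'P.
  by rewrite -[h (g _)]/((h \o g) _) -e /= subrr.
(* s is only a section of sets, but D s does not depend on its choice. *)
have [s sP] := choice (@po_surj _ _ (S X)).
have Ds x : D (s (po_map (S X) x)) = D x.
  by apply/eqP; rewrite -subr_eq0 -linearB D0 // linearB sP subrr.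
have Dl : linear (fun x => D (s x)).
  by move=> c x y; rewrite -[RHS](linearP D) -[RHS]Ds linearP !sP.
apply/stable_pi_eq0; exists (S Y), (mk_linear Dl), (po_map (S Y)).
by split=> [|x]; [exact: po_proj | rewrite /= DE sP].
Qed.

Lemma xi_succ (k : residueField R) (M : fgMod R) (P : projRes M) j :
  Ext_vanishes P j.+1 R^o -> xi nR S k j M = xi nR S k j.+1 M.
Proof.
move=> E0; rewrite /xi; congr dimension; apply/seteqP; split=> f /=.
  by move=> ->; apply: Omega0.
exact/Omega_inj/Ext_vanishes_ker_ext/E0.
Qed.

End Resolutions.

(** * Local rings *)

Section LocalRing.
Variable R : comNzRingType.

Lemma exists_maximal_ideal (J : set R) : is_ideal J -> ~ J 1 ->
  exists m, maximal_ideal m /\ (J `<=` m)%classic.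
Proof.
move=> iJ J1.
pose proper I := [/\ is_ideal I, ~ I 1 & (J `<=` I)%classic].
have [|m [[m0|[im m1 Jm]] mmax]] :=
    @Zorn_bigcup R [set I | I = set0 \/ proper I]%classic.
(* The empty set is allowed because the union of an empty chain is empty. *)
- move=> F FP Ft.
  have [Fe|/existsNP[I /not_implyP[FI I0]]] := pselect (forall I, F I -> I = set0).
    by left; apply/seteqP; split=> // x [I /Fe -> ].
  have [//|[[Iz _ _] _ JI]] := FP I FI; right.
  have FE I' x : F I' -> I' x -> proper I'.
    by move=> /FP[->|].
  split.
  - split.
    + by exists I.
    + move=> x y [I1 F1 x1] [I2 F2 y2].
      have [[_ D1 _] _ _] := FE _ _ F1 x1; have [[_ D2 _] _ _] := FE _ _ F2 y2.
      case: (Ft I1 I2 F1 F2) => sub.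
        by exists I2 => //; apply: D2 => //; apply: sub.
      by exists I1 => //; apply: D1 => //; apply: sub.
    + move=> a x [I1 F1 x1]; exists I1 => //.
      by have [[_ _ M1] _ _] := FE _ _ F1 x1; apply: M1.
  - by move=> [I1 F1 x1]; have [_ + _] := FE _ _ F1 x1.
  - by move=> x /JI Ix; exists I.
- exfalso; apply: (mmax J); last by right; split.
  by rewrite m0; split=> // /(_ 0); apply; case: iJ.
- exists m; split=> //; split=> // I iI mI I1.
  apply/seteqP; split=> //; apply: contrapT => nIm.
  by apply: (mmax I); [split | right; split=> //; apply: subset_trans mI].
Qed.

(** In a local ring, an element outside of the maximal ideal is a unit. *)
Lemma local_res_map_unit (lR : local_ring R) (k : residueField R) (a : R) :
  res_map k a != 0 -> exists b, b * a = 1.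
Proof.
move=> a0; apply: contrapT => na.
have [||m [mm Jm]] := @exists_maximal_ideal [set x | exists b, x = b * a]%classic.
- split; first by exists 0; rewrite mul0r.
  + by move=> _ _ [b ->] [c ->]; exists (b + c); rewrite mulrDl.
  + by move=> c _ [b ->]; exists (c * b); rewrite mulrA.
- by move=> [b b1]; apply: na; exists b.
case: lR => m' [_ uniq].
have : m a by apply: Jm; exists 1; rewrite mul1r.
by rewrite -(uniq _ mm) (uniq _ (res_map_ker k)) /=; apply/eqP.
Qed.

End LocalRing.

(** * Dual systems and free summands *)

Section DualSystems.
Variable R : comNzRingType.

(** Functionals phi_i on M and elements x_j of M with phi_i(x_j) = delta_ij. *)
Definition dual_system (M : lmodType R) d
    (phi : 'I_d -> {linear M -> R^o}) (x : 'I_d -> M) : Prop :=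
  forall i j, phi i (x j) = (i == j)%:R.

Lemma free_summand_dual_system (M : lmodType R) d :
  free_summand M d <-> exists phi x, @dual_system M d phi x.
Proof.
split=> [[N [f [f' f'K fK]]]|[phi [x phix]]].
  have pl i : linear (fun y => (f y).1 0 i : R^o).
    by move=> c y z; rewrite linearP !mxE.
  exists (fun i => mk_linear (pl i)), (fun j => f' (delta_mx 0 j, 0)) => i j.
  by rewrite /= fK /= mxE eqxx.
(* The map p with coordinates phi_i is split by q; its kernel is the complement. *)
have [p pE] : exists p : {linear M -> 'rV[R]_d}, forall y i, p y 0 i = phi i y.
  have pl : linear (fun y => \row_i (phi i y : R)).
    by move=> c y z; apply/rowP => i; rewrite !mxE linearP.
  by exists (mk_linear pl) => y i; rewrite mxE.
pose q (v : 'rV[R]_d) := \sum_j v 0 j *: x j.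
have qD u v c : q (c *: u + v) = c *: q u + q v.
  rewrite /q scaler_sumr -big_split /=; apply: eq_bigr => i _.
  by rewrite !mxE scalerDl scalerA.
have pq v : p (q v) = v.
  apply/rowP => i; rewrite pE linear_sum (bigD1 i) //= linearZ /= phix eqxx.
  rewrite big1 ?addr0 => [|j ji]; first by rewrite [LHS]mulr1.
  by rewrite linearZ /= phix eq_sym (negPf ji) [LHS]mulr0.
have rk y : y - q (p y) \in lkernel p.
  by apply/eqP; rewrite linearB pq subrr.
have fl : linear (fun y => (p y, KerMod (rk y) : kerMod p)).
  move=> c y z; apply: injective_projections; first exact: linearP.
  by apply: val_inj; rewrite /= linearP qD opprD addrACA -scalerBr.
exists (kerMod p), (mk_linear fl), (fun u => q u.1 + ker_val u.2).
- by move=> y /=; rewrite addrC subrK.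
- move=> [v [y y0]] /=; have py := eqP y0.
  apply: injective_projections => /=; first by rewrite linearD pq py addr0.
  by apply: val_inj; rewrite /= linearD pq py addr0 addrAC subrr add0r.
Qed.

(** Over the residue field, the identity matrix of size d factors through k^n. *)
Lemma dual_system_bound (k : residueField R) (M : lmodType R) n (g : 'I_n -> M)
    d (phi : 'I_d -> {linear M -> R^o}) x :
  (forall y, exists c : 'I_n -> R, y = \sum_i c i *: g i) ->
  dual_system phi x -> (d <= n)%N.
Proof.
move=> gP phix; have [c cP] := choice (fun j => gP (x j)).
pose A : 'M[k]_(d, n) := \matrix_(j, l) res_map k (c j l).
pose B : 'M[k]_(n, d) := \matrix_(l, i) res_map k (phi i (g l)).
have AB : A *m B = 1%:M.
  apply/matrixP => j i; rewrite !mxE -[RHS](rmorph_nat (res_map k)).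
  rewrite eq_sym -phix cP linear_sum rmorph_sum; apply: eq_bigr => l _.
  by rewrite !mxE linearZ -rmorphM.
by rewrite -(mxrank1 k d) -AB (leq_trans (mxrankM_maxl _ _)) ?rank_leq_col.
Qed.

Lemma dual_system_extend (M : lmodType R) d
    (phi : 'I_d -> {linear M -> R^o}) x (psi : {linear M -> R^o}) y b :
  dual_system phi x -> (forall j, psi (x j) = 0) -> b * (psi y : R) = 1 ->
  exists phi' x', @dual_system M d.+1 phi' x'.
Proof.
move=> phix psix by1.
(* The component of y annihilated by all the phi_i, normalized so that psi z = 1. *)
pose z := b *: (y - \sum_i (phi i y : R) *: x i).
have phiz i : phi i z = 0.
  rewrite linearZ /= linearB linear_sum (bigD1 i) //= big1 => [|j ji]; last first.
    by rewrite linearZ /= phix eq_sym (negPf ji) [LHS]mulr0.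
  by rewrite addr0 linearZ /= phix eqxx [X in _ - X]mulr1 subrr scaler0.
have psiz : psi z = 1.
  rewrite linearZ /= linearB linear_sum big1 ?subr0 // => i _.
  by rewrite linearZ /= psix scaler0.
exists (fun i => oapp phi psi (unlift ord0 i)), (fun j => oapp x z (unlift ord0 j)).
move=> i j; case: (unliftP ord0 i) => [i' ->|->]; case: (unliftP ord0 j) => [j' ->|->] /=.
- by rewrite phix (inj_eq lift_inj).
- by rewrite phiz.
- by rewrite psix.
- by rewrite psiz.
Qed.

Lemma factors_projective_res (k : residueField R) (M : lmodType R)
    (f : {linear M -> resMod k}) :
  factors_projective f <->
  exists psi : {linear M -> R^o}, forall y, f y = res_map k (psi y).
Proof.
have pl : linear (res_map k : R^o -> resMod k).
  by move=> c x y; rewrite rmorphD rmorphM.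
split=> [[P [g [h [pP e]]]]|[psi e]].
  have [h' h'P] := pP _ _ (mk_linear pl) h (@res_map_surj _ k).
  by exists (h' \o g) => y; rewrite e /= -h'P.
exists 'rV[R]_1.
have gl : linear (fun y => \row_(_ < 1) (psi y : R)).
  by move=> c y z; apply/rowP => i; rewrite !mxE linearP.
have hl : linear (fun v : 'rV[R]_1 => res_map k (v 0 0) : resMod k).
  by move=> c y z; rewrite !mxE rmorphD rmorphM.
exists (mk_linear gl), (mk_linear hl); split; first exact: projective_rV.
by move=> y; rewrite e /= mxE.
Qed.

End DualSystems.

(** * The invariant xi(0, M) *)

Section Xi0.
Variables (R : comNzRingType) (lR : local_ring R) (k : residueField R).

(** If a dual system cannot be enlarged by one, the reductions of its
    functionals form a basis of the maps M -> k that factor through a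
    projective module. *)
Lemma maximal_dual_system_basis (M : lmodType R) d
    (phi : 'I_d -> {linear M -> R^o}) x :
  dual_system phi x -> ~ (exists phi' x', @dual_system R M d.+1 phi' x') ->
  exists b : 'I_d -> {linear M -> resMod k},
    is_basis [set f | factors_projective f]%classic b.
Proof.
move=> phix dmax.
have pl i : linear (fun y => res_map k (phi i y) : resMod k).
  by move=> c y z; rewrite linearP rmorphD rmorphM.
have sumE (c : 'I_d -> k) y : (\sum_i c i *: mk_linear (pl i)) y =
    \sum_i c i * res_map k (phi i y).
  by elim/big_ind2: _ => [|f1 y1 f2 y2 <- <-|].
exists (fun i => mk_linear (pl i)); split.
- by move=> i /=; apply/factors_projective_res; exists (phi i).
- move=> c c0 j; have := sumE c (x j); rewrite c0 (bigD1 j) //= phix eqxx.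
  rewrite rmorph1 mulr1 big1 ?addr0 => [<- //|i ij].
  by rewrite phix (negPf ij) rmorph0 mulr0.
move=> v /= /factors_projective_res[psi vE].
exists (fun j => res_map k (psi (x j))); apply: linear_ext => y.
rewrite sumE vE.
(* psi' kills all the x_j; a unit value psi' y would enlarge the system. *)
have psi'l : linear (fun z => psi z - \sum_j (psi (x j) : R) *: phi j z).
  move=> c z w; rewrite linearP scalerBr addrACA scaler_sumr -opprD -big_split.
  by congr (_ - _); apply: eq_bigr => j _;
     rewrite linearP scalerDr !scalerA mulrC.
have psi'E z : mk_linear psi'l z = psi z - \sum_j (psi (x j) : R) *: phi j z by [].
move: (mk_linear psi'l) psi'E => psi' psi'E.
have psi'x j : psi' (x j) = 0.
  rewrite psi'E (bigD1 j) //= phix eqxx big1 => [|i ij]; last first.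
    by rewrite phix (negPf ij) scaler0.
  by rewrite addr0 [X in _ - X]mulr1 subrr.
have : res_map k (psi' y) = 0.
  apply/eqP; apply: contrapT => /negP /(local_res_map_unit lR)[b b1].
  exact/dmax/(dual_system_extend phix psi'x b1).
rewrite psi'E rmorphB rmorph_sum => /eqP; rewrite subr_eq0 => /eqP ->.
by apply: eq_bigr => j _; rewrite rmorphM.
Qed.

Lemma xi0_largest_free_summand (nR : noetherian_ring R)
    (S : forall X : fgMod R, projOnto X) (M : fgMod R) :
  largest_free_summand_rank M (xi nR S k 0 M).
Proof.
have [n [g gP]] := fg_modP M.
pose D d := `[< exists phi x, @dual_system R M d phi x >].
have D0 : exists d, D d.
  by exists 0%N; apply/asboolP; exists (fun=> \0), (fun=> 0) => -[].
have Dn d : D d -> (d <= n)%N.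
  by move=> /asboolP[phi [x]]; apply: (dual_system_bound k gP).
case: (ex_maxnP D0 Dn) => d /asboolP[phi [x phix]] dmax.
have -> : xi nR S k 0 M = d.
  have [|b bB] := maximal_dual_system_basis phix.
    by move=> /asboolP /dmax; rewrite ltnn.
  rewrite /xi; apply: (dimensionP (b := b)).
  congr (is_basis _ b): bB; apply/seteqP; split=> f /=; last by move=> /stable_pi_eq0.
  by move=> /stable_pi_eq0.
split=> [|s /free_summand_dual_system /asboolP /dmax //].
by apply/free_summand_dual_system; exists phi, x.
Qed.

End Xi0.

Theorem corollary4p12 (R : comNzRingType) (nR : noetherian_ring R)
    (lR : local_ring R) (k : residueField R)
    (S : forall X : fgMod R, projOnto X)
    (M : fgMod R) (P : projRes M) (n : nat) :
  (forall a b : nat, (0 < a)%N -> (a <= b)%N ->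
     (forall i : nat, (a <= i <= b)%N -> Ext_vanishes P i R^o) ->
     forall i : nat, (a <= i <= b)%N -> xi nR S k i.-1 M = xi nR S k i M)
  /\
  ((forall i : nat, (1 <= i <= n)%N -> Ext_vanishes P i R^o) ->
     forall j : nat, (j <= n)%N ->
       largest_free_summand_rank M (xi nR S k j M)).
Proof.
split=> [a b a0 _ E0 [|i] iab|E0 j jn].
- by case: a a0 iab {E0}.
- exact/xi_succ/E0.
elim: j jn => [|j IHj] jn; first exact: xi0_largest_free_summand.
by rewrite -(xi_succ _ _ _ (E0 j.+1 jn)); apply/IHj/ltnW.
Qed.
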